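(* A connected graph $G$ does not contain any subdivision of the paw as an induced subgraph if and only if $G$ is a cycle, or $G$ is a complete $k$-partite graph for some $k\geq 2$, or $G$ is a tree.
   Context: The paw is the graph on four vertices with four edges that contains a triangle (a triangle plus a pendant edge). A subdivision of a graph is obtained by replacing edges by paths (a graph counts as a subdivision of itself). A complete $k$-partite graph ($k\ge1$) consists of $k$ pairwise disjoint non-empty stable sets, every two of which are completely joined. *)

(* Defs.v *)
From mathcomp Require Import all_boot.

Set Implicit Arguments.
Unset Strict Implicit.
Unset Printing Implicit Defensive.

(* Finite simple graphs. *)
Record sgraph := SGraph {
  vertex :> finType;
  adj : rel vertex;
  adj_sym : symmetric adj;
  adj_irrefl : irreflexive adj
}.

Definition induced_subgraph (S G : sgraph) : Prop :=
  exists2 h : S -> G, injective h & {mono h : x y / adj x y}.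

(* The null graph is not connected. *)
Definition connected_graph (G : sgraph) : Prop :=
  0 < #|G| /\ (forall x y : G, connect (@adj G) x y).

Definition acyclic (G : sgraph) : Prop :=
  forall c : seq G, ucycle (@adj G) c -> size c < 3.

Definition is_tree (G : sgraph) : Prop := connected_graph G /\ acyclic G.

(* [c] lists the vertices in cyclic order, and there are no other edges than
   those between cyclically consecutive vertices. *)
Definition is_cycle (G : sgraph) : Prop :=
  exists c : seq G,
    [/\ 3 <= size c, uniq c, (forall x : G, x \in c)
      & forall x y : G, adj x y = (next c x == y) || (next c y == x)].

Definition stable (G : sgraph) (A : {set G}) : Prop :=
  {in A &, forall x y, ~~ adj x y}.

Definition completely_joined (G : sgraph) (A B : {set G}) : Prop :=
  forall x y, x \in A -> y \in B -> adj x y.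

(* The blocks of a [partition] are nonempty. *)
Definition complete_partite (k : nat) (G : sgraph) : Prop :=
  exists P : {set {set G}},
    [/\ partition P [set: G], #|P| = k, {in P, forall A, stable A}
      & {in P &, forall A B, A != B -> completely_joined A B}].

(* [S] is obtained from [H] by replacing each edge [uv] by a path from [f u] to
   [f v] whose sequence of interior vertices is [p u v] (empty when the edge is
   kept); [p v u] is the same path, traversed backwards. *)
Definition subdivision (S H : sgraph) : Prop :=
  exists (f : H -> S) (p : H -> H -> seq S),
    let path_of u v := f u :: rcons (p u v) (f v) in
    [/\ injective f,
        (forall u v, adj u v -> p v u = rev (p u v)),
        (forall u v, adj u v -> uniq (p u v)),
        (forall u v w, adj u v -> f w \notin p u v)
      & [/\ (forall u v u' v' x, adj u v -> adj u' v' ->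
               x \in p u v -> x \in p u' v' ->
               (u' = u /\ v' = v) \/ (u' = v /\ v' = u)),
            (forall x : S, (exists u, x = f u) \/
               (exists u v, adj u v /\ x \in p u v))
          & (forall x y : S, adj x y <->
               (exists u v, adj u v /\ infix [:: x; y] (path_of u v)))]].

(* Triangle 0, 1, 2 and the pendant edge joining 2 to 3. *)
Definition paw_edges : seq (nat * nat) := [:: (0, 1); (0, 2); (1, 2); (2, 3)].

Definition paw_adj : rel 'I_4 := fun i j =>
  ((val i, val j) \in paw_edges) || ((val j, val i) \in paw_edges).

Lemma paw_adj_sym : symmetric paw_adj.
Proof. by move=> i j; rewrite /paw_adj orbC. Qed.

Lemma paw_adj_irrefl : irreflexive paw_adj.
Proof. by case=> [[|[|[|[|i]]]] lti]. Qed.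

Definition paw : sgraph := SGraph paw_adj_sym paw_adj_irrefl.

(* Main.v *)
Require Import Defs.
From mathcomp Require Import all_boot.

(** If [G] is not a tree, take a shortest cycle [c], which is chordless.  When
    [c] has at least five vertices, a vertex outside [c] has at most one
    neighbour on it, so a vertex attached to [c] would give a subdivided paw:
    hence [G] is [c].  When [c] has three or four vertices it induces a complete
    multipartite graph, that is, one in which non-adjacency is transitive.  Such
    a set in which every vertex has two neighbours stays so when a vertex [x]
    adjacent to it is added, since otherwise a paw, or a square with a pendant
    edge, appears; by connectedness the set grows to all of [G].
    Conversely, a subdivided paw has a vertex of degree three, a cycle, and a
    vertex anticomplete to an edge, which excludes cycles, trees and complete
    multipartite graphs respectively. *)

Set Implicit Arguments.
Unset Strict Implicit.
Unset Printing Implicit Defensive.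

(** * Subdivisions inside a graph *)

Section Induced.
Variables (G : sgraph) (A : {set G}).

Definition induced_adj : rel {x : G | x \in A} := fun x y => adj (val x) (val y).

Lemma induced_adj_sym : symmetric induced_adj.
Proof. by move=> x y; rewrite /induced_adj adj_sym. Qed.

Lemma induced_adj_irrefl : irreflexive induced_adj.
Proof. by move=> x; rewrite /induced_adj adj_irrefl. Qed.

Definition induced_on : sgraph := SGraph induced_adj_sym induced_adj_irrefl.

Lemma induced_onP : induced_subgraph induced_on G.
Proof. by exists val; [exact: val_inj | move=> x y]. Qed.

End Induced.

Lemma infix_map_inj (T T' : eqType) (f : T -> T') (s t : seq T) :
  injective f -> infix (map f s) (map f t) = infix s t.
Proof.
move=> injf; apply/infixP/infixP => [[s1 [s2 eq_t]]|[s1 [s2 ->]]]; last first.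
  by exists (map f s1), (map f s2); rewrite !map_cat.
exists (take (size s1) t), (drop (size s1 + size s) t).
apply: (inj_map injf); rewrite !map_cat map_take map_drop eq_t.
rewrite take_size_cat // addnC -drop_drop drop_size_cat //.
by rewrite -(size_map f s) drop_size_cat.
Qed.

(** Lets a subdivision be exhibited by branch vertices [F] and interiors [P] living in [G] itself;
    the passage to the subgraph induced on [A] is made here once. *)
Lemma subdivision_in (G H : sgraph) (A : {set G}) (F : H -> G)
    (P : H -> H -> seq G) :
  injective F ->
  (forall u v, adj u v -> P v u = rev (P u v)) ->
  (forall u v, adj u v -> uniq (P u v)) ->
  (forall u v w, adj u v -> F w \notin P u v) ->
  (forall u v u' v' x, adj u v -> adj u' v' -> x \in P u v -> x \in P u' v' ->
     (u' = u /\ v' = v) \/ (u' = v /\ v' = u)) ->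
  (forall x, x \in A <->
     (exists u, x = F u) \/ (exists u v, adj u v /\ x \in P u v)) ->
  {in A &, forall x y, adj x y <->
     (exists u v, adj u v /\ infix [:: x; y] (F u :: rcons (P u v) (F v)))} ->
  exists S : sgraph, subdivision S H /\ induced_subgraph S G.
Proof.
move=> injF revP uniqP FP disjP memA adjA.
exists (induced_on A); split; last exact: induced_onP.
have FA u : F u \in A by apply/memA; left; exists u.
have PA u v : adj u v -> {subset P u v <= A}.
  by move=> uv x xP; apply/memA; right; exists u, v.
pose f u : induced_on A := exist _ (F u) (FA u).
(* [pmap insub] drops entries outside [A]; along an edge of [H] there are none, by [PA]. *)
pose p u v : seq (induced_on A) := pmap insub (P u v).
have val_p u v : adj u v -> map val (p u v) = P u v.
  move=> uv; rewrite pmap_filter; last exact: insubK.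
  by apply/all_filterP/allP=> x /(PA _ _ uv) xA; rewrite /= insubT.
have mem_p u v x : (x \in p u v) = (val x \in P u v) by rewrite mem_pmap_sub.
have uniq_p u v : adj u v -> uniq (p u v) by move=> uv; apply/pmap_sub_uniq/uniqP.
move: p val_p mem_p uniq_p => p val_p mem_p uniq_p; exists f, p; split.
- by move=> u v /(congr1 val) /= /injF.
- move=> u v uv; apply: (inj_map val_inj).
  have vu : adj v u by rewrite adj_sym.
  by rewrite map_rev (val_p _ _ uv) (val_p _ _ vu) revP.
- exact: uniq_p.
- by move=> u v w uv; rewrite mem_p FP.
split.
- by move=> u v u' v' x uv uv'; rewrite !mem_p; apply: disjP.
- move=> x; have /memA[[u eqx]|[u [v [uv xP]]]] := valP x.
    by left; exists u; apply: val_inj.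
  by right; exists u, v; rewrite mem_p.
move=> x y; rewrite {1}/adj /= /induced_adj.
have infE u v : adj u v -> infix [:: x; y] (f u :: rcons (p u v) (f v)) =
    infix [:: val x; val y] (F u :: rcons (P u v) (F v)).
  move=> uv; rewrite -(infix_map_inj [:: x; y] _ (@val_inj _ _ _)).
  by rewrite !map_cons map_rcons val_p.
apply: (iff_trans (adjA _ _ (valP x) (valP y))).
split=> -[u [v [uv inf]]]; exists u, v; split=> //.
  exact: etrans (infE _ _ uv) inf.
exact: etrans (esym (infE _ _ uv)) inf.
Qed.

(** * Chordless cycles with a pendant edge *)

Lemma infix2_next (T : eqType) (v : T) (s : seq T) (x : T) :
  x \in v :: s -> infix [:: x; next (v :: s) x] (v :: rcons s v).
Proof.
(* The current head is generalised, while the vertex returned to at the end stays [v]. *)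
rewrite /next; elim: s {1 3 4}v => [|z s IHs] y /=.
  by rewrite inE => /eqP->; rewrite !eqxx.
rewrite inE; have [->|_ /= /IHs /= ->//] := eqVneq x y.
by rewrite !eqxx /= prefix0s.
Qed.

Lemma infix2_path (T : eqType) (e : rel T) (v : T) (s : seq T) (x y : T) :
  path e v s -> infix [:: x; y] (v :: s) -> e x y.
Proof.
elim: s v => [|z s IHs] v /=; first by rewrite andbF.
case/andP=> vz /IHs inf; case/orP; last exact: inf.
by case/andP=> /eqP -> /andP[/eqP -> _].
Qed.

Definition chordless (G : sgraph) (c : seq G) : Prop :=
  {in c &, forall x y, adj x y -> (next c x == y) || (next c y == x)}.

Definition has_paw_subdivision (G : sgraph) : Prop :=
  exists S : sgraph, subdivision S paw /\ induced_subgraph S G.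

(** The cycle with its pendant edge is itself the subdivided paw: the vertices 0, 1, 2, 3 go to [a],
    [b], [v], [x], and only the edge 12 is subdivided, with interior [s]. An empty [s] gives the
    paw. *)
Lemma pendant_cycle_paw_subdivision (G : sgraph) (v a b x : G) (s : seq G) :
  let c := [:: v, a, b & s] in
  ucycle (@adj G) c -> chordless c -> x \notin c -> adj v x ->
  {in a :: b :: s, forall y, ~~ adj x y} -> has_paw_subdivision G.
Proof.
move=> c /andP[cyc_c uniq_c] chord_c x_c vx Nx.
have /and3P[va ab path_b] : [&& adj v a, adj a b & path (@adj G) b (rcons s v)] by [].
pose F (i : paw) := match val i with 0 => a | 1 => b | 2 => v | _ => x end.
pose P (i j : paw) := match val i, val j with
  | 1, 2 => s | 2, 1 => rev s | _, _ => [::] end.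
have memP i j y : y \in P i j ->
    y \in s /\ ((val i = 1 /\ val j = 2) \/ (val i = 2 /\ val j = 1)).
  rewrite /P; case: (val i) (val j) => [|[|[|i']]] [|[|[|j']]] //.
    by split; auto.
  by rewrite mem_rev; split; auto.
have symP i j : P j i = rev (P i j).
  by rewrite /P; case: (val i) (val j) => [|[|[|i']]] [|[|[|j']]]; rewrite ?revK.
move: (uniq_c); rewrite /c !cons_uniq !inE !negb_or.
case/and4P=> /and3P[v_a v_b v_s] /andP[a_b a_s] b_s uniq_s.
move: (x_c); rewrite /c !inE !negb_or => /and4P[x_v x_a x_b x_s].
have neqs := (negPf v_a, negPf v_b, negPf a_b, negPf x_v, negPf x_a, negPf x_b).
pose E y z := exists i j : paw,
  adj i j /\ infix [:: y; z] (F i :: rcons (P i j) (F j)).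
(* By symmetry, one orientation of each edge is enough below. *)
have symE y z : E y z -> E z y.
  case=> i [j [ij inf]]; exists j, i; split; first by rewrite adj_sym.
  by rewrite -infix_rev !rev_cons rev_rcons symP revK.
pose o k (ltk : k < 4) : paw := Ordinal ltk.
apply: (@subdivision_in G paw [set y in x :: c] F P) => //.
- move=> [[|[|[|[|//]]]] ?] [[|[|[|[|//]]]] ?]; rewrite /F /= => eqF;
    apply: val_inj => //=; move: eqF => /eqP; by [rewrite ?neqs | rewrite eq_sym ?neqs].
- move=> i j _; rewrite /P.
  by case: (val i) (val j) => [|[|[|?]]] [|[|[|?]]] //; rewrite rev_uniq.
- move=> i j k _; apply/negP=> /memP[Fs _]; move: Fs; rewrite /F.
  case: (val k) => [|[|[|?]]]; exact/negP.
- move=> i j i' j' y _ _ /memP[_ ij] /memP[_ ij'].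
  case: ij ij' => -[i_ j_] [[i'_ j'_]|[i'_ j'_]]; [left | right | right | left];
  by split; apply: val_inj; rewrite ?i_ ?j_.
- move=> y; rewrite !inE; split=> [|[[i ->]|[i [j [_ /memP[-> _]]]]]]; last 2 first.
  + by rewrite /F; case: (val i) => [|[|[|?]]]; rewrite eqxx ?orbT.
  + by rewrite !orbT.
  case/or4P=> [/eqP->|/eqP->|/eqP->|/orP[/eqP->|ys]].
  + by left; exists (o 3 isT).
  + by left; exists (o 2 isT).
  + by left; exists (o 0 isT).
  + by left; exists (o 1 isT).
  by right; exists (o 1 isT), (o 2 isT).
move=> y z; rewrite !(inE, in_set) => yA zA; split; last first.
  case=> i [j [ij]]; apply: infix2_path.
  (* Serves the edge 12 read from 2 to 1, whose interior is [rev s]. *)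
  have path_v : path (@adj G) v (rcons (rev s) b).
    have := rev_path (@adj G) b (rcons s v).
    rewrite last_rcons belast_rcons rev_cons => ->.
    by rewrite (eq_path (e' := @adj G)) // => ? ?; rewrite adj_sym.
  case: i j ij => [[|[|[|[|//]]]] ?] [[|[|[|[|//]]]] ?];
  rewrite /F /P //= => _; rewrite ?va ?ab ?vx // adj_sym ?va ?ab ?vx //.
have xE w : w \in x :: c -> adj x w -> E x w.
  rewrite inE => /orP[/eqP->|]; first by rewrite adj_irrefl.
  rewrite inE => /orP[/eqP-> _|/Nx/negPf-> //].
  by exists (o 3 isT), (o 2 isT); rewrite /= !eqxx.
(* The pair is the edge [v a], the edge [a b], or a step of the path from [b] through [s] back to
   [v]. *)
have nextE w : w \in c -> E w (next c w).
  move=> /infix2_next; rewrite -/c /= => /or3P[inf|inf|inf].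
  + exists (o 2 isT), (o 0 isT); split=> //.
    by case/andP: inf => /eqP-> /andP[/eqP-> _]; rewrite /= !eqxx.
  + exists (o 0 isT), (o 1 isT); split=> //.
    by case/andP: inf => /eqP-> /andP[/eqP-> _]; rewrite /= !eqxx.
  by exists (o 1 isT), (o 2 isT).
move=> yz; case/orP: (yA) => [/eqP eq_y|yc].
  by move: yz; rewrite eq_y; apply: xE; rewrite inE.
case/orP: (zA) => [/eqP eq_z|zc].
  by move: yz; rewrite eq_z adj_sym => yz; apply/symE/xE; rewrite // inE.
case/orP: (chord_c y z yc zc yz) => /eqP <-; first exact: nextE.
exact/symE/nextE.
Qed.

Lemma adj_neq (G : sgraph) (x y : G) : adj x y -> x != y.
Proof. by apply: contraTneq => ->; rewrite adj_irrefl. Qed.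

Lemma paw_paw_subdivision (G : sgraph) (v a b x : G) :
  adj v a -> adj a b -> adj v b -> adj v x -> ~~ adj x a -> ~~ adj x b ->
  has_paw_subdivision G.
Proof.
move=> va ab vb vx xa xb.
have [/negPf v_a /negPf a_b /negPf v_b] := And3 (adj_neq va) (adj_neq ab) (adj_neq vb).
have [a_v b_a b_v] : [/\ (a == v) = false, (b == a) = false & (b == v) = false].
  by split; rewrite eq_sym.
apply: (@pendant_cycle_paw_subdivision G v a b x [::]) => //.
- by rewrite /ucycle /= va ab adj_sym vb !inE v_a v_b a_b.
- move=> y z; rewrite !inE => /or3P[]/eqP-> /or3P[]/eqP->;
  by rewrite /= ?eqxx ?adj_irrefl // ?(v_a, a_b, v_b, a_v, b_a, b_v) ?eqxx ?orbT.
- rewrite !inE !negb_or eq_sym (adj_neq vx) /=.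
  (* If [x] were [a] it would be adjacent to [b], and if it were [b], to [a]. *)
  by rewrite (contraNneq _ xb) ?(contraNneq _ xa) // => ->; rewrite // adj_sym.
- by move=> y; rewrite !inE => /orP[]/eqP->.
Qed.

Lemma square_paw_subdivision (G : sgraph) (v a b d x : G) :
  adj v a -> adj a b -> adj b d -> adj d v -> ~~ adj v b -> ~~ adj a d ->
  a != d -> adj v x -> ~~ adj x a -> ~~ adj x b -> ~~ adj x d ->
  has_paw_subdivision G.
Proof.
move=> va ab bd dv nvb nad /negPf a_d vx xa xb xd.
have /negPf v_b : v != b by apply: contraNneq xb => <-; rewrite adj_sym.
have [/negPf v_a /negPf a_b] := (adj_neq va, adj_neq ab).
have [/negPf b_d /negPf d_v] := (adj_neq bd, adj_neq dv).
have [a_v b_a d_b] : [/\ (a == v) = false, (b == a) = false & (d == b) = false].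
  by split; rewrite eq_sym.
have [v_d b_v d_a] : [/\ (v == d) = false, (b == v) = false & (d == a) = false].
  by split; rewrite eq_sym.
have [nbv nda] : (adj b v = false) * (adj d a = false).
  by split; apply: negbTE; rewrite adj_sym.
apply: (@pendant_cycle_paw_subdivision G v a b x [:: d]) => //.
- by rewrite /ucycle /= va ab bd dv !inE v_a v_b a_b v_d a_d b_d.
- move=> y z; rewrite !inE => /or4P[]/eqP-> /or4P[]/eqP->;
  by rewrite /= ?eqxx ?adj_irrefl ?nbv ?nda ?(negPf nvb) ?(negPf nad) //
    ?(v_a, a_b, b_d, d_v, v_b, a_d, a_v, b_a, d_b, v_d, b_v, d_a) ?eqxx ?orbT.
- rewrite !inE !negb_or eq_sym (adj_neq vx) /=.
  apply/and3P; split; [move: xb|move: xa|move: xb]; apply: contraNneq => ->;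
  by rewrite // adj_sym.
- by move=> y; rewrite !inE => /or3P[]/eqP->.
Qed.

(** * Sets inducing a complete multipartite graph *)

(** Non-adjacency is always reflexive and symmetric, so transitivity makes it an equivalence whose
    classes are the parts. A single part is allowed, and no parts need be tracked when [W] grows. *)
Definition multipartite_on (G : sgraph) (W : {set G}) : Prop :=
  {in W & &, forall x y z, ~~ adj x y -> ~~ adj y z -> ~~ adj x z}.

(* Every vertex of [W] has at least two neighbours in [W]. *)
Definition two_neighbours_on (G : sgraph) (W : {set G}) : Prop :=
  {in W &, forall x y, exists z, [/\ z \in W, z != y & adj x z]}.

Section Extension.
Variables (G : sgraph) (W : {set G}) (x a : G).
Hypothesis no_paw : ~ has_paw_subdivision G.
Hypothesis mW : multipartite_on W.

Hypothesis dW : two_neighbours_on W.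
Hypothesis xW : x \notin W.
Hypothesis aW : a \in W.
Hypothesis ax : adj a x.

Lemma non_neighbours_stable :
  {in W &, forall b c, ~~ adj x b -> ~~ adj x c -> ~~ adj b c}.
Proof.
(* If [a] is adjacent to both [b] and [c], the triangle [a b c] with [x] attached at [a] is a paw;
   otherwise [b] and [c] may be swapped so that [a] and [b] are not adjacent. *)
suff wlog_stable b c : b \in W -> c \in W -> ~~ adj x b -> ~~ adj x c ->
    ~~ adj a b -> ~~ adj b c.
  move=> b c bW cW xb xc; apply/negP=> bc.
  have [ab|nab] := boolP (adj a b); last first.
    by move: (wlog_stable b c bW cW xb xc nab); rewrite bc.
  have [ac|nac] := boolP (adj a c); last first.
    by move: (wlog_stable c b cW bW xc xb nac); rewrite adj_sym bc.
  by apply: no_paw; apply: (@paw_paw_subdivision G a b c x).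
move=> bW cW xb xc nab; apply/negP=> bc; apply: no_paw.
have ac : adj a c.
  by apply: contraLR bc => nac; apply: (@mW b a c) => //; rewrite adj_sym.
(* [d] is a second neighbour of [a]. Its adjacency to [c] and to [x] decides between three paws and
   the square [a d b c] with [x] attached at [a]. *)
have [d [dinW d_c ad]] := dW aW cW.
have bd : adj b d.
  by apply: contraLR ad => nbd; apply: (@mW a b d).
have [dc|ndc] := boolP (adj d c); have [xd|nxd] := boolP (adj x d).
- apply: (@paw_paw_subdivision G d b c x) => //; by rewrite adj_sym.
- exact: (@paw_paw_subdivision G a d c x).
- apply: (@paw_paw_subdivision G a x d c) => //; by rewrite adj_sym.
- by apply: (@square_paw_subdivision G a d b c x); rewrite // adj_sym.
Qed.

(** A neighbour [d] of [b] is adjacent to [x] by stability and to [c] by transitivity; were [x]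
    adjacent to [c], the vertex [b] would hang at [d] on the triangle [d x c]. *)
Lemma non_neighbours_closed :
  {in W &, forall b c, ~~ adj x b -> ~~ adj b c -> ~~ adj x c}.
Proof.
move=> b c bW cW xb nbc; apply/negP=> xc.
have [d [dinW _ bd]] := dW bW bW.
have xd : adj x d.
  by apply: contraLR bd => nxd; apply: non_neighbours_stable.
have cd : adj c d.
  by apply: contraLR bd => ncd; apply: (@mW b c d).
by apply: no_paw; apply: (@paw_paw_subdivision G d x c b) => //; rewrite adj_sym.
Qed.

Lemma multipartite_extend : multipartite_on (x |: W).
Proof.
move=> u v w; rewrite !in_setU1.
case/predU1P=> [->|uW] /predU1P[->|vW] /predU1P[->|wW] //.
- by rewrite adj_irrefl.
- exact: non_neighbours_closed.
- by rewrite adj_sym => vx xw; apply: non_neighbours_stable.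
- rewrite !(adj_sym _ x) (adj_sym u) => vu xv.
  exact: non_neighbours_closed vu.
- exact: mW.
Qed.

Lemma two_neighbours_extend : two_neighbours_on (x |: W).
Proof.
have inW z : z \in W -> z \in x |: W by apply: setU1r.
move=> u v; rewrite !in_setU1 => /predU1P[->|uW] vxW.
  have [->|a_v] := eqVneq v a; last first.
    by exists a; split; rewrite // 1?eq_sym ?inW // adj_sym.
  (* Non-neighbours of [x] are stable, so [x] has a neighbour on every edge of [W]; the edge [b b']
     is chosen to avoid [a]. *)
  have [b [bW b_a ab]] := dW aW aW.
  have [b' [b'W b'_a bb']] := dW bW aW.
  have [xb|nxb] := boolP (adj x b); first by exists b; rewrite inW.
  exists b'; rewrite inW //; split=> //.
  by apply: contraLR bb' => nxb'; apply: non_neighbours_stable.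
case/predU1P: vxW => [->|vW].
  have [z [zW _ uz]] := dW uW uW; exists z; rewrite inW //; split=> //.
  by apply: contraNneq xW => <-.
by have [z [zW z_v uz]] := dW uW vW; exists z; rewrite inW.
Qed.

End Extension.

(** If no edge left [W], a path from [w] could never reach a vertex outside. *)
Lemma connected_boundary (G : sgraph) (W : {set G}) (w : G) :
  connected_graph G -> w \in W -> W != setT ->
  exists x a, [/\ x \notin W, a \in W & adj a x].
Proof.
move=> [_ conn] wW; rewrite -subTset => /subsetPn[y _ yW].
have [closedW|] := boolP [forall a in W, forall x, adj a x ==> (x \in W)].
  case/connectP: (conn w y) => p path_p eq_y; case/negP: yW; rewrite {}eq_y.
  elim: p w wW path_p => //= z p IHp w wW /andP[wz]; apply: IHp.
  by move/'forall_in_forallP: closedW => /(_ w wW z)/implyP; apply.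
rewrite negb_forall_in => /exists_inP[a aW].
by rewrite negb_forall => /existsP[x]; rewrite negb_imply => /andP[ax xW]; exists x, a.
Qed.

Lemma multipartite_connected (G : sgraph) (W : {set G}) (w : G) :
  connected_graph G -> ~ has_paw_subdivision G -> w \in W ->
  multipartite_on W -> two_neighbours_on W -> multipartite_on [set: G].
Proof.
move=> conn no_paw.
have [n] := ubnP #|~: W|; elim: n W => // n IHn W leWn wW mW dW.
have [<- //|neqW] := eqVneq W setT.
have [x [a [xW aW ax]]] := connected_boundary conn wW neqW.
apply: (IHn (x |: W)).
- move: leWn; rewrite ltnS; apply: leq_trans; rewrite setCU setIC -setDE [leqRHS](cardsD1 x).
  by rewrite inE xW.
- exact: setU1r.
- exact: multipartite_extend ax.
- exact: two_neighbours_extend ax.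
Qed.

(** The parts are the classes of non-adjacency; the edge [x y] separates two of them, whence
    [2 <= k]. *)
Lemma multipartite_complete_partite (G : sgraph) (x y : G) :
  adj x y -> multipartite_on [set: G] ->
  exists k, 2 <= k /\ complete_partite k G.
Proof.
move=> xy mG; pose R : rel G := fun u v => ~~ adj u v.
have eqR : {in setT & &, equivalence_rel R}.
  move=> u v w _ _ _; split=> [|uv]; first by rewrite /R adj_irrefl.
  apply/idP/idP; apply: mG => //; by rewrite adj_sym.
set P := equivalence_partition R setT; have partP := equivalence_partitionP eqR.
have pbP u v : (u \in pblock P v) = ~~ adj v u by apply: pblock_equivalence_partition.
have inP A u : A \in P -> u \in A -> pblock P u = A.
  by apply: def_pblock; case/and3P: partP.
exists #|P|; split; last first.
  exists P; split=> // [A AP u v uA vA|A B AP BP neqAB u v uA vB].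
    by rewrite -pbP (inP A u).
  apply: contraR neqAB; rewrite -pbP => vAu.
  rewrite (inP A u) // in vAu.
  by rewrite -(inP A v) // (inP B v).
have pbin u : pblock P u \in P by rewrite pblock_mem // (cover_partition partP).
rewrite (cardsD1 (pblock P x)) pbin (cardsD1 (pblock P y)) !inE pbin andbT.
suff -> : pblock P y != pblock P x by [].
by apply: contraTneq xy => eq_xy; rewrite -pbP -eq_xy pbP adj_irrefl.
Qed.

(** * Shortest cycles *)

(** [p1] and [p2] are the interiors of the two arcs between [x] and [y]; either arc can later be
    closed up to a new cycle. *)
Lemma ucycle_arcs (T : eqType) (e : rel T) (c : seq T) (x y : T) :
  ucycle e c -> x \in c -> y \in c -> x != y ->
  exists p1 p2, [/\ path e x (rcons p1 y), path e y (rcons p2 x),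
    perm_eq c (x :: p1 ++ y :: p2),
    p1 = [::] -> next c x = y & p2 = [::] -> next c y = x].
Proof.
case/andP=> cyc_c uniq_c xc yc neq_xy.
case: (rot_to_arc uniq_c xc yc neq_xy) => i p1 p2 _ _ rot_c; exists p1, p2.
have := rot_cycle i e c.
rewrite cyc_c rot_c /= rcons_cat /= -cat_rcons cat_path last_rcons => /andP[-> ->].
split=> //; first by rewrite -rot_c perm_sym perm_rot.
  by move=> p1_nil; rewrite -(next_rot i) // rot_c p1_nil /= eqxx.
(* Rotating past [x] and [p1] brings [y] to the front. *)
move=> p2_nil; rewrite -(next_rot i) // rot_c -(next_rot (size p1).+1) ?p2_nil.
  by rewrite -cat_cons -[_.+1]/(size (x :: p1)) rot_size_cat /= eqxx.
by rewrite -p2_nil -rot_c rot_uniq.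
Qed.

(** A cycle without repetitions has at most [#|G|] vertices, so its existence is a bounded,
    decidable search and no excluded middle is assumed. *)
Lemma acyclic_or_shortest_cycle (G : sgraph) :
  acyclic G \/ exists c : seq G, [/\ ucycle (@adj G) c, 3 <= size c &
    forall c' : seq G, ucycle (@adj G) c' -> 3 <= size c' -> size c <= size c'].
Proof.
pose P n := (3 <= n) && [exists t : n.-tuple G, ucycleb (@adj G) t].
have inP c : ucycle (@adj G) c -> 3 <= size c -> P (size c).
  by move=> cyc_c c3; rewrite /P c3; apply/existsP; exists (in_tuple c).
have [[n exP]|noP] := pickP (fun n : 'I_#|G|.+1 => P n); last first.
  left=> c cyc_c; rewrite ltnNge; apply/negP=> c3.
  have lec : size c < #|G|.+1.
    by case/andP: cyc_c => _ uniq_c; rewrite ltnS -(card_uniqP uniq_c) max_card.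
  by have := noP (Ordinal lec); rewrite /= inP.
right; have [|m /andP[m3 /existsP[c cyc_c]] minm] := @ex_minnP P; first by exists n.
by exists c; rewrite size_tuple; split=> // c' cyc_c' c'3; apply/minm/inP.
Qed.

Section ShortestCycle.
Variables (G : sgraph) (c : seq G).
Hypothesis cyc_c : ucycle (@adj G) c.
Hypothesis c3 : 3 <= size c.
Hypothesis min_c :
  forall c' : seq G, ucycle (@adj G) c' -> 3 <= size c' -> size c <= size c'.

Lemma shortest_cycle_le (x y : G) (p : seq G) :
  path (@adj G) x (rcons p y) -> uniq (x :: rcons p y) -> 0 < size p ->
  adj x y -> size c <= (size p).+2.
Proof.
move=> path_p uniq_p p_gt0 xy.
have := min_c (c' := x :: rcons p y); rewrite [size (_ :: _)]/= size_rcons; apply=> //.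
by rewrite /ucycle /= rcons_path path_p last_rcons adj_sym xy.
Qed.

(** A chord would close the arc with interior [p1] to a cycle shorter than [c] by the size of
    [p2]. *)
Lemma shortest_cycle_chordless : chordless c.
Proof.
move=> x y xc yc xy.
have [p1 [p2 [path1 _ perm_c next1 next2]]] :=
  ucycle_arcs cyc_c xc yc (adj_neq xy).
case: (posnP (size p1)) => [/size0nil/next1->|p1_gt0]; first by rewrite eqxx.
case: (posnP (size p2)) => [/size0nil/next2->|p2_gt0]; first by rewrite eqxx orbT.
have := perm_size perm_c; rewrite /= size_cat /= addnS => size_c.
have: uniq c by case/andP: cyc_c.
rewrite (perm_uniq perm_c) -cat_rcons -cat_cons cat_uniq => /andP[uniq_xy _].
have := shortest_cycle_le path1 uniq_xy p1_gt0 xy.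
by rewrite size_c !ltnS -{2}[size p1]addn0 leq_add2l leqNgt p2_gt0.
Qed.

(** Each arc between distinct [a] and [b] closes through [x] to a cycle no shorter than [c]; so the
    opposite arc has at most one interior vertex, and [c] at most four vertices. *)
Lemma shortest_cycle_unique_neighbour (x a b : G) :
  4 < size c -> x \notin c -> a \in c -> b \in c -> adj x a -> adj x b -> a = b.
Proof.
move=> c5 xc ac bc xa xb; apply/eqP; apply: contraLR c5 => neq_ab.
have [p1 [p2 [path1 path2 perm_c _ _]]] := ucycle_arcs cyc_c ac bc neq_ab.
have := perm_size perm_c; rewrite /= size_cat /= addnS => size_c.
have: uniq (x :: c) by rewrite /= xc; case/andP: cyc_c.
have perm_xc : perm_eq (x :: c) (x :: a :: p1 ++ b :: p2) by rewrite perm_cons.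
rewrite (perm_uniq perm_xc) => uniq_xc.
have p2_le1 : size p2 <= 1.
  have: size c <= (size (a :: p1)).+2.
    apply: (@shortest_cycle_le x b) => //=; first by rewrite xa.
    by move: uniq_xc; rewrite -cat_rcons -!cat_cons cat_uniq => /andP[].
  by rewrite size_c /= !ltnS -addn1 leq_add2l.
have p1_le1 : size p1 <= 1.
  have: size c <= (size (b :: p2)).+2.
    apply: (@shortest_cycle_le x a) => //=; first by rewrite xb.
    have perm_ba : perm_eq (a :: p1 ++ b :: p2) (b :: rcons p2 a ++ p1).
      by rewrite cat_rcons -!cat_cons perm_catC.
    move: uniq_xc; rewrite -cons_uniq /= -[_ && uniq _]/(uniq (a :: _)).
    rewrite (perm_mem perm_ba) (perm_uniq perm_ba) -[_ && _]/(uniq (x :: _)).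
    by rewrite -!cat_cons cat_uniq => /andP[].
  by rewrite size_c /= !ltnS addnC -addn1 leq_add2l.
by rewrite size_c -leqNgt !ltnS (leq_add p1_le1 p2_le1).
Qed.

Lemma cycle_two_neighbours : two_neighbours_on [set x in c].
Proof.
move=> x y; rewrite !inE => xc _.
have [i s rot_c] := rot_to xc.
have memc z : (z \in c) = (z \in x :: s) by rewrite -rot_c mem_rot.
have /andP[cyc_s uniq_s] : ucycle (@adj G) (x :: s) by rewrite -rot_c rot_ucycle.
have: 3 <= size (x :: s) by rewrite -rot_c size_rot.
case: s {rot_c} memc cyc_s uniq_s => [|b [|d s]] // memc cyc_s uniq_s _.
have [eq_yb|neq_yb] := eqVneq b y; last first.
  by exists b; split=> //; [rewrite inE memc !inE eqxx orbT | case/andP: cyc_s].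
(* The predecessor of [x], distinct from its successor [b] since [c] has at least three entries. *)
exists (last d s); split; first by rewrite inE memc 2!in_cons mem_last !orbT.
  by rewrite -eq_yb; apply: contraTneq uniq_s => eq_l; rewrite /= -eq_l mem_last andbF.
by rewrite adj_sym; move: cyc_s; rewrite /= rcons_path => /and4P[].
Qed.

(** Distinct non-adjacent [x] and [y] leave one interior vertex on each arc, both adjacent to [y]; a
    non-neighbour [z] of [y] is then [x] or [y]. *)
Lemma short_cycle_multipartite : size c <= 4 -> multipartite_on [set x in c].
Proof.
move=> c4 x y z; rewrite !inE => xc yc zc nxy nyz.
have [->//|neq_xy] := eqVneq x y.
have [p1 [p2 [path1 path2 perm_c _ _]]] := ucycle_arcs cyc_c xc yc neq_xy.
have := perm_size perm_c; rewrite /= size_cat /= addnS => size_c.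
case: p1 => [|w1 [|w1' p1]] /= in path1 perm_c size_c.
- by rewrite (negPf nxy) in path1.
- case: p2 => [|w2 [|w2' p2]] /= in path2 perm_c size_c.
  + by rewrite adj_sym (negPf nxy) in path2.
  + case/andP: path1 => _ /andP[w1y _]; case/andP: path2 => yw2 _.
    move: zc; rewrite (perm_mem perm_c) !inE.
    case/or4P=> /eqP eq_z; rewrite eq_z ?adj_irrefl //.
    * by rewrite eq_z adj_sym w1y in nyz.
    * by rewrite eq_z yw2 in nyz.
  + by rewrite size_c !ltnS in c4.
- case: p2 => [|w2 p2] /= in path2 perm_c size_c.
    by rewrite adj_sym (negPf nxy) in path2.
  by rewrite size_c addnS !ltnS in c4.
Qed.

End ShortestCycle.

(** Different blocks are joined, so non-adjacent vertices share a block; hence [x] and [z] lie in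
    one stable block. *)
Lemma complete_partite_multipartite (G : sgraph) (k : nat) :
  complete_partite k G -> multipartite_on [set: G].
Proof.
case=> P [partP _ stableP joinP] x y z _ _ _ nxy nyz.
have /and3P[/eqP covP trivP _] := partP.
have same u v : ~~ adj u v -> pblock P u = pblock P v.
  move=> nuv; apply/eqP; apply: contraNT nuv => neq_uv.
  by apply: (joinP (pblock P u) (pblock P v)); rewrite ?mem_pblock ?pblock_mem ?covP ?inE.
apply: (stableP (pblock P x)); rewrite ?pblock_mem ?mem_pblock ?covP ?inE //.
by rewrite (same x y nxy) (same y z nyz) mem_pblock covP inE.
Qed.

(** * The subdivided paw *)

Lemma path_infix2 (T : eqType) (e : rel T) (v : T) (s : seq T) :
  (forall x y, infix [:: x; y] (v :: s) -> e x y) -> path e v s.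
Proof.
elim: s v => //= z s IHs v inf; rewrite inf ?eqxx ?prefix0s //=.
by apply: IHs => x y /= xy; apply: inf; rewrite xy orbT.
Qed.

Section SubdividedPaw.
Variables (S : sgraph) (f : paw -> S) (p : paw -> paw -> seq S).
Hypothesis injf : injective f.
Hypothesis symp : forall u v, adj u v -> p v u = rev (p u v).
Hypothesis uniqp : forall u v, adj u v -> uniq (p u v).
Hypothesis fp : forall u v w, adj u v -> f w \notin p u v.
Hypothesis disjp : forall u v u' v' x, adj u v -> adj u' v' ->
  x \in p u v -> x \in p u' v' -> (u' = u /\ v' = v) \/ (u' = v /\ v' = u).
Hypothesis adjE : forall x y : S, adj x y <->
  (exists u v, adj u v /\ infix [:: x; y] (f u :: rcons (p u v) (f v))).

Let o0 : paw := Ordinal (isT : 0 < 4).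
Let o1 : paw := Ordinal (isT : 1 < 4).
Let o2 : paw := Ordinal (isT : 2 < 4).
Let o3 : paw := Ordinal (isT : 3 < 4).

Lemma subdivision_path u v : adj u v -> path (@adj S) (f u) (rcons (p u v) (f v)).
Proof. by move=> uv; apply: path_infix2 => x y xy; apply/adjE; exists u, v. Qed.

(** [v] is the branch vertex 2; its three neighbours are not claimed to be pairwise non-adjacent. *)
Lemma subdivision_claw : exists v x y z : S,
  [/\ adj v x, adj v y, adj v z & uniq [:: x; y; z]].
Proof.
(* First vertex after [f o2] on the way to [f u]; the default [f u] serves an edge that is kept. *)
pose n u := head (f u) (p o2 u).
have adjn u : adj o2 u -> adj (f o2) (n u).
  by move=> /subdivision_path; rewrite /n; case: (p o2 u) => [|w s] /= /andP[].
have memn u : n u = f u \/ n u \in p o2 u.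
  by rewrite /n; case: (p o2 u) => [|w s]; [left | right; rewrite mem_head].
have neqn u v : adj o2 u -> adj o2 v -> u != v -> n u != n v.
  move=> ou ov; apply: contra_neq => eqn.
  have [nu|nu] := memn u; have [nv|nv] := memn v.
  - by apply: injf; rewrite -nu -nv.
  - by rewrite -eqn nu (negPf (fp _ _)) in nv.
  - by rewrite eqn nv (negPf (fp _ _)) in nu.
  - rewrite -eqn in nv; case: (disjp ou ov nu nv) => -[] // eq_ou.
    by rewrite eq_ou adj_irrefl in ou.
exists (f o2), (n o0), (n o1), (n o3); split; try exact: adjn.
by rewrite /= !inE negb_or !neqn.
Qed.

Lemma subdivision_has_cycle : exists2 c : seq S, ucycle (@adj S) c & 3 <= size c.
Proof.
exists (f o2 :: p o2 o0 ++ f o0 :: p o0 o1 ++ f o1 :: p o1 o2); last first.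
  by rewrite /= size_cat /= size_cat /= !addnS.
rewrite /ucycle; apply/andP; split.
  rewrite /= !(rcons_cat, rcons_cons) -!cat_rcons !cat_path !last_rcons.
  by rewrite !subdivision_path.
(* With the branch vertices in front, uniqueness splits: they are distinct, none is interior, and
   the interiors are disjoint and repetition-free. *)
have perm_c : perm_eq (f o2 :: p o2 o0 ++ f o0 :: p o0 o1 ++ f o1 :: p o1 o2)
    ([:: f o2; f o0; f o1] ++ p o2 o0 ++ p o0 o1 ++ p o1 o2).
  apply/permP => P; rewrite /= !count_cat /= !count_cat /=.
  by rewrite !(addnCA (P (f o1))) !(addnCA (P (f o0))).
have disj u v u' v' : adj u v -> adj u' v' ->
    (u' \notin [:: u; v]) || (v' \notin [:: u; v]) -> ~~ has (mem (p u v)) (p u' v').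
  move=> uv uv' neq; apply/hasPn => x xuv'; apply/negP => xuv; move: neq.
  by case: (disjp uv uv' xuv xuv') => -[-> ->]; rewrite !inE !eqxx !orbT.
rewrite (perm_uniq perm_c) cat_uniq; apply/and3P; split.
- by rewrite /= !inE !(inj_eq injf).
- apply/hasPn => x; rewrite !mem_cat !inE => xp.
  by apply/negP => /or3P[]/eqP eqx; move: xp; rewrite eqx !(negPf (fp _ _)).
by rewrite !cat_uniq !uniqp //= has_cat negb_or !disj.
Qed.

(* The end of the pendant path and the first edge of the subdivided edge 01. *)
Lemma subdivision_co_path : exists x a b : S, [/\ ~~ adj x a, ~~ adj x b & adj a b].
Proof.
pose b := head (f o1) (p o0 o1).
have ab : adj (f o0) b.
  have := subdivision_path (isT : adj o0 o1); rewrite /b.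
  by case: (p o0 o1) => [|w s] /= /andP[].
have memb : b = f o1 \/ b \in p o0 o1.
  by rewrite /b; case: (p o0 o1) => [|w s]; [left | right; rewrite mem_head].
(* The only neighbour of 3 in the paw is 2, so every edge at [f o3] lies on the pendant path. *)
have N3 y : adj (f o3) y -> y \in [:: f o2, f o3 & p o2 o3].
  case/adjE=> u [v [uv /mem_infix sub]].
  have: f o3 \in f u :: rcons (p u v) (f v) by apply: sub; rewrite mem_head.
  rewrite inE mem_rcons inE (negPf (fp _ _)) // orbF !(inj_eq injf).
  have: y \in f u :: rcons (p u v) (f v) by apply: sub; rewrite !inE eqxx orbT.
  rewrite inE mem_rcons !inE => yuv /orP[]/eqP eq3; rewrite -eq3 in uv yuv.
    have eq2 : v = o2 by case: v uv {sub yuv} => [[|[|[|[|//]]]] ?] // _; apply: val_inj.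
    by move: yuv; rewrite eq2 (symp (isT : adj o2 o3)) mem_rev orbCA.
  have eq2 : u = o2 by case: u uv {sub yuv} => [[|[|[|[|//]]]] ?] // _; apply: val_inj.
  by move: yuv; rewrite eq2.
exists (f o3), (f o0), b; split=> //; apply/negP=> /N3; rewrite !inE.
  by rewrite !(inj_eq injf) (negPf (fp _ _)).
case: memb => [->|bp]; first by rewrite !(inj_eq injf) (negPf (fp _ _)).
case/or3P=> [/eqP eqb|/eqP eqb|bp'].
- by rewrite eqb (negPf (fp _ _)) in bp.
- by rewrite eqb (negPf (fp _ _)) in bp.
by have [[]|[]] := @disjp o0 o1 o2 o3 b isT isT bp bp'.
Qed.

End SubdividedPaw.

(** * Exclusion of subdivided paws from the three classes *)

Lemma multipartite_no_paw_subdivision (G : sgraph) :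
  multipartite_on [set: G] -> ~ has_paw_subdivision G.
Proof.
move=> mG [S [[f [p [injf symp uniqp fp [disjp _ adjE]]]] [h _ monoh]]].
have [x [a [b [nxa nxb]]]] := subdivision_co_path injf symp fp disjp adjE.
(* Transitivity through [h x] would make [h a] and [h b] non-adjacent. *)
apply/negP; rewrite -monoh; apply: (mG (h a) (h x) (h b)); rewrite ?inE ?monoh //.
by rewrite adj_sym.
Qed.

Lemma acyclic_no_paw_subdivision (G : sgraph) :
  acyclic G -> ~ has_paw_subdivision G.
Proof.
move=> acG [S [[f [p [injf _ uniqp fp [disjp _ adjE]]]] [h injh monoh]]].
have [c /andP[cyc_c uniq_c]] := subdivision_has_cycle injf uniqp fp disjp adjE.
rewrite -(size_map h) leqNgt acG // /ucycle map_inj_uniq // uniq_c andbT.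
by rewrite cycle_map (eq_cycle (e' := @adj S)) // => x y; rewrite /= monoh.
Qed.

Lemma cycle_no_paw_subdivision (G : sgraph) : is_cycle G -> ~ has_paw_subdivision G.
Proof.
case=> c [_ uniq_c memc adjE] [S [[f [p [injf _ _ fp [disjp _ adjSE]]]] [h injh monoh]]].
have [v [x [y [z [vx vy vz uniq_xyz]]]]] := subdivision_claw injf fp disjp adjSE.
have nbr w : adj v w -> h w \in [:: next c (h v); prev c (h v)].
  rewrite -monoh adjE !inE => /orP[]/eqP eqw; first by rewrite eqw eqxx.
  by rewrite -eqw prev_next // eqxx orbT.
have: uniq (map h [:: x; y; z]) by rewrite map_inj_uniq.
(* Three distinct neighbours do not fit among the successor and the predecessor of [h v]. *)
move/uniq_leq_size => /(_ [:: next c (h v); prev c (h v)]) le32.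
suff: 2 < 2 by []; apply: le32 => w /mapP[u xyz_u ->]; apply: nbr.
by move: xyz_u; rewrite !inE => /or3P[]/eqP->.
Qed.

Theorem mainTheorem5 (G : sgraph) (hG : connected_graph G) :
  ~ (exists S : sgraph, subdivision S paw /\ induced_subgraph S G) <->
  (is_cycle G \/ (exists k : nat, 2 <= k /\ complete_partite k G) \/ is_tree G).
Proof.
split; last first.
  case=> [|[[k [_ partG]]|[_ acG]]]; first exact: cycle_no_paw_subdivision.
    exact/multipartite_no_paw_subdivision/(complete_partite_multipartite partG).
  exact: acyclic_no_paw_subdivision.
move=> no_paw; have [acG|[c [cyc_c c3 min_c]]] := acyclic_or_shortest_cycle G.
  by right; right.
have chord_c := shortest_cycle_chordless cyc_c min_c.
have [w wc] : exists w, w \in c.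
  by case: c c3 {cyc_c min_c chord_c} => // w c _; exists w; rewrite mem_head.
have wW : w \in [set x in c] by rewrite inE.
have cyc_adj : cycle (@adj G) c by case/andP: cyc_c.
have uniq_c : uniq c by case/andP: cyc_c.
have [c4|c5] := leqP (size c) 4.
  right; left; apply: (multipartite_complete_partite (next_cycle cyc_adj wc)).
  apply: (multipartite_connected hG no_paw wW).
    exact: short_cycle_multipartite.
  exact: cycle_two_neighbours.
(* From length five on, either [c] covers [G], which is then a cycle, or a vertex attached to [c]
   gives a subdivided paw. *)
have [/setP setc|neqc] := eqVneq [set x in c] setT.
  have memc x : x \in c by have := setc x; rewrite !inE.
  left; exists c; split=> // x y; apply/idP/idP; first exact: chord_c.
  by case/orP=> /eqP<-; [|rewrite adj_sym]; apply: next_cycle.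
have [x [a []]] := connected_boundary hG wW neqc.
rewrite !inE => xc ac ax; case: no_paw.
(* The cycle is rotated to start at the vertex [a] where [x] is attached. *)
have [i s rot_c] := rot_to ac.
have memc z : (z \in c) = (z \in a :: s) by rewrite -rot_c mem_rot.
have cyc_s : ucycle (@adj G) (a :: s) by rewrite -rot_c rot_ucycle.
have chord_s : chordless (a :: s).
  by move=> y z; rewrite -!memc -rot_c !next_rot //; apply: chord_c.
have: 2 < size (a :: s) by rewrite -rot_c size_rot.
case: s {rot_c} memc cyc_s chord_s => [|b [|d s]] // memc cyc_s chord_s _.
apply: (@pendant_cycle_paw_subdivision G a b d x s); rewrite -?memc //.
(* A further neighbour of [x] on the cycle would equal [a], which does not recur there. *)
move=> y ys; apply/negP=> xy; case/andP: (cyc_s) => _ /andP[/negP[]].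
have yc : y \in c by rewrite memc inE ys orbT.
suff -> : a = y by [].
by apply: (shortest_cycle_unique_neighbour cyc_c min_c c5 xc); rewrite // adj_sym.
Qed.
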